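(* Let $(\mathfrak g,[\cdot,\cdot]_{\mathfrak g},\rhd)$ be a post-Lie algebra over $\mathbf k$ with sub-adjacent Lie algebra $\mathfrak g_\rhd$, and let $\phi:\mathrm U(\mathfrak g_\rhd)\to\mathrm U(\mathfrak g)_\rhd$ be the Guin-Oudom isomorphism. Then its inverse $\phi^{-1}:\mathrm U(\mathfrak g)_\rhd\to\mathrm U(\mathfrak g_\rhd)$ is given by $$\phi^{-1}(x_1\cdots x_n)=\sum_\pi(-1)^{n-|\pi|}\,[x_{B_1}]\cdots[x_{B_{|\pi|}}],\qquad\forall\,x_1,\dots,x_n\in\mathfrak g,$$ where $x_1\cdots x_n$ on the left is the product in $\mathrm U(\mathfrak g)$ (usual multiplication), the products on the right are in $\mathrm U(\mathfrak g_\rhd)$, and the sum ranges over all set partitions $\pi=(B_1,\dots,B_{|\pi|})$ of $[n]=\{1,\dots,n\}$ into (nonempty) blocks, indexed so that $\max B_1<\cdots<\max B_{|\pi|}$. Here for $I=\{i_1<\cdots<i_r\}\subseteq[n]$, $[x_I]:=\sum_{w\in S_{r-1}}[x_{i_1},\dots,x_{i_{r-1}};x_{i_r}]_w\in\mathfrak g$, with the convention $[x_{\{i\}}]=x_i$ for all $i\in[n]$.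
   Context: $\mathbf k$ is an algebraically closed field of characteristic $0$; everything is over $\mathbf k$. Sweedler notation: $\Delta(u)=u_1\otimes u_2$ (summation suppressed). A post-Lie algebra $(\mathfrak g,[\cdot,\cdot]_{\mathfrak g},\rhd)$ is a Lie algebra $(\mathfrak g,[\cdot,\cdot]_{\mathfrak g})$ with a bilinear product $\rhd:\mathfrak g\otimes\mathfrak g\to\mathfrak g$ such that $x\rhd[y,z]_{\mathfrak g}=[x\rhd y,z]_{\mathfrak g}+[y,x\rhd z]_{\mathfrak g}$ and $([x,y]_{\mathfrak g}+x\rhd y-y\rhd x)\rhd z=x\rhd(y\rhd z)-y\rhd(x\rhd z)$. Its sub-adjacent Lie algebra $\mathfrak g_\rhd$ is the vector space $\mathfrak g$ with bracket $[x,y]_{\mathfrak g_\rhd}=x\rhd y-y\rhd x+[x,y]_{\mathfrak g}$. The product $\rhd$ extends to the universal enveloping algebra $\mathrm U(\mathfrak g)$ (with its usual Hopf algebra structure: multiplication, $\Delta$, $\varepsilon$, $S$) recursively by: $x\rhd 1=0$, $x\rhd x_1\cdots x_r=\sum_{i=1}^r x_1\cdots(x\rhd x_i)\cdots x_r$, $1\rhd u=u$, and $x_1\cdots x_r\rhd u=x_1\rhd(x_2\cdots x_r\rhd u)-(x_1\rhd x_2\cdots x_r)\rhd u$, for $x,x_1,\dots,x_r\in\mathfrak g$, $u\in\mathrm U(\mathfrak g)$, $r\ge1$ (known to be well defined). The sub-adjacent Hopf algebra is $\mathrm U(\mathfrak g)_\rhd=(\mathrm U(\mathfrak g),\circ,1,\Delta,\varepsilon,S_\rhd)$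 with the same unit, coproduct and counit as $\mathrm U(\mathfrak g)$ and product $u\circ v=u_1\,(u_2\rhd v)$ (known to be a Hopf algebra). The Guin-Oudom isomorphism is the Hopf algebra isomorphism $\phi:\mathrm U(\mathfrak g_\rhd)\to\mathrm U(\mathfrak g)_\rhd$, $\phi(x_1\cdots x_r)=x_1\circ\cdots\circ x_r$ for $x_1,\dots,x_r\in\mathfrak g$ (known to be a well-defined isomorphism). Definition of $[x_1,\dots,x_r;y]_w\in\mathfrak g$ for $x_1,\dots,x_r,y\in\mathfrak g$ and a permutation $w\in S_r$: start with the sequence $x_{w(1)},x_{w(2)},\dots,x_{w(r)},y$. For $k=1,2,\dots,r$ successively, take the entry of the current sequence which involves $x_k$ (treating $x_1,\dots,x_r$ as formal symbols), call it $A$, and let $C$ be the entry immediately to its right; replace the two adjacent entries $A,C$ by the single entry $A\rhd C$. After $r$ steps one entry remains, and it is $[x_1,\dots,x_r;y]_w$. For example, $[x_1,\dots,x_6;y]_{256314}=((x_2\rhd x_5)\rhd x_6)\rhd((x_3\rhd(x_1\rhd x_4))\rhd y)$ (with $w$ in one-line notation). *)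

(* Defs.v *)
From HB Require Import structures.
From mathcomp Require Import all_boot perm all_algebra.
From mathcomp Require Import sesquilinear ssrAC.
From mathcomp Require Import boolp.

Set Implicit Arguments.
Unset Strict Implicit.
Unset Printing Implicit Defensive.

Import GRing.Theory.
Local Open Scope ring_scope.
Local Open Scope quotient_scope.

Record lieAlg (k : fieldType) := LieAlg {
  lie_sort :> lmodType k;
  lie_bracket : {bilinear lie_sort -> lie_sort -> lie_sort};
  lie_alternating : forall x, lie_bracket x x = 0;
  lie_jacobi : forall x y z,
    lie_bracket x (lie_bracket y z) + lie_bracket y (lie_bracket z x)
      + lie_bracket z (lie_bracket x y) = 0
}.

Record postLieAlg (k : fieldType) := PostLieAlg {
  pl_lie :> lieAlg k;
  pl_tri : {bilinear pl_lie -> pl_lie -> pl_lie};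
  pl_deriv : forall x y z,
    pl_tri x (lie_bracket pl_lie y z)
      = lie_bracket pl_lie (pl_tri x y) z + lie_bracket pl_lie y (pl_tri x z);
  pl_assoc : forall x y z,
    pl_tri (lie_bracket pl_lie x y + pl_tri x y - pl_tri y x) z
      = pl_tri x (pl_tri y z) - pl_tri y (pl_tri x z)
}.

Section SubAdjacentLie.
Variables (k : fieldType) (g : postLieAlg k).

Definition sub_bracket (x y : g) : g :=
  pl_tri g x y - pl_tri g y x + lie_bracket g x y.

Fact sub_bracket_linearl (y : g) : linear (sub_bracket^~ y).
Proof.
move=> a u v; rewrite /sub_bracket linearPl linearPr linearPl /=.
by rewrite !scalerDr scalerN opprD [LHS](AC (2*2*2) ((1*3*5)*(2*4*6))).
Qed.

Fact sub_bracket_linearr (x : g) : linear (sub_bracket x).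
Proof.
move=> a u v; rewrite /sub_bracket linearPl !linearPr /=.
by rewrite !scalerDr scalerN opprD [LHS](AC (2*2*2) ((1*3*5)*(2*4*6))).
Qed.

HB.instance Definition _ := isBilinear.Build k g g g *:%R *:%R sub_bracket
  (fun y => zmod_morphism_linear (sub_bracket_linearl y))
  (fun x => zmod_morphism_linear (sub_bracket_linearr x))
  (fun y => scalable_linear (sub_bracket_linearl y))
  (fun x => scalable_linear (sub_bracket_linearr x)).

Fact sub_bracket_alternating (x : g) : sub_bracket x x = 0.
Proof. by rewrite /sub_bracket subrr lie_alternating addr0. Qed.

Fact lie_anticomm (x y : g) : lie_bracket g x y = - lie_bracket g y x.
Proof.
apply/eqP; rewrite -addr_eq0; apply/eqP.
have := lie_alternating (x + y).
by rewrite linearDl !linearDr !lie_alternating add0r addr0.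
Qed.

Fact sub_bracket_jacobi (x y z : g) :
  sub_bracket x (sub_bracket y z) + sub_bracket y (sub_bracket z x)
    + sub_bracket z (sub_bracket x y) = 0.
Proof.
have expand (u v w : g) : sub_bracket u (sub_bracket v w) =
    (pl_tri g u (pl_tri g v w) - pl_tri g u (pl_tri g w v)
      - pl_tri g v (pl_tri g w u) + pl_tri g w (pl_tri g v u))
    + (lie_bracket g (pl_tri g u v) w - lie_bracket g (pl_tri g u w) v
      - lie_bracket g (pl_tri g v w) u + lie_bracket g (pl_tri g w v) u)
    + lie_bracket g u (lie_bracket g v w).
  rewrite {1}/sub_bracket.
  have -> : pl_tri g (sub_bracket v w) u
      = pl_tri g v (pl_tri g w u) - pl_tri g w (pl_tri g v u).
    by rewrite -pl_assoc /sub_bracket; congr (pl_tri g _ u); rewrite addrC addrA.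
  rewrite /sub_bracket !linearDr !linearNr pl_deriv.
  rewrite (lie_anticomm v) (lie_anticomm u (pl_tri g v w)).
  rewrite (lie_anticomm u (pl_tri g w v)) opprK opprB.
  by rewrite [LHS](AC ((2*2)*2*3) ((1*2*6*5)*(3*4*7*8)*9)).
have cancel6 (a b c a' b' c' : g) :
    (a - a' - b + b') + (b - c' - c + a') + (c - b' - a + c') = 0.
  rewrite [LHS](AC (4*4*4) ((1*11)*(8*2)*(5*3)*(4*10)*(9*7)*(12*6))) /=.
  by rewrite !subrr !addr0.
rewrite !expand [LHS](AC (3*3*3) ((1*4*7)*(2*5*8)*(3*6*9))) /= lie_jacobi addr0.
by rewrite !cancel6 addr0.
Qed.

Definition sub_adjacent : lieAlg k :=
  LieAlg sub_bracket_alternating sub_bracket_jacobi.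

End SubAdjacentLie.

(** [tens V W] is the quotient of the formal sums [v1 (x) w1 + ... + vn (x) wn],
    written as lists of pairs, identifying two sums when no bilinear map on
    [V * W] separates them, i.e. when they agree in the tensor product. *)

Section Tensor.
Variables (k : fieldType) (V W : lmodType k).

Definition tens_eval (E : lmodType k) (B : V -> W -> E) (t : seq (V * W)) : E :=
  \sum_(p <- t) B p.1 p.2.

Definition tens_rel : rel (seq (V * W)) := fun t u =>
  `[< forall (E : lmodType k) (B : {bilinear V -> W -> E}),
        tens_eval B t = tens_eval B u >].

Fact tens_rel_refl : reflexive tens_rel.
Proof. by move=> t; apply/asboolP. Qed.

Fact tens_rel_sym : symmetric tens_rel.
Proof. by move=> t u; apply/asboolP/asboolP => tu E B. Qed.

Fact tens_rel_trans : transitive tens_rel.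
Proof. by move=> t u v /asboolP ut /asboolP tv; apply/asboolP => E B; rewrite ut. Qed.

Canonical tens_equiv := EquivRel tens_rel tens_rel_refl tens_rel_sym tens_rel_trans.

Definition tens : Type := {eq_quot tens_equiv}.

HB.instance Definition _ := Choice.on tens.

Definition tens_mk (t : seq (V * W)) : tens := \pi_({eq_quot tens_equiv}) t.
Definition tens_repr (t : tens) : seq (V * W) :=
  @repr _ {eq_quot tens_equiv} t.

Definition tens_lift (E : lmodType k) (B : {bilinear V -> W -> E}) (t : tens) : E :=
  tens_eval B (tens_repr t).

Lemma tens_lift_mk (E : lmodType k) (B : {bilinear V -> W -> E}) t :
  tens_lift B (tens_mk t) = tens_eval B t.
Proof.
suff /eqmodP/asboolP : tens_repr (tens_mk t) = t %[mod {eq_quot tens_equiv}] by exact.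
by rewrite /tens_repr reprK.
Qed.

Lemma tens_ext (t u : tens) :
  (forall (E : lmodType k) (B : {bilinear V -> W -> E}),
     tens_lift B t = tens_lift B u) -> t = u.
Proof.
move=> tu; rewrite -[t]reprK -[u]reprK; apply/eqmodP/asboolP => E B.
exact: tu.
Qed.

Definition tens_pure (v : V) (w : W) : tens := tens_mk [:: (v, w)].
Definition tens_zero : tens := tens_mk [::].
Definition tens_add (t u : tens) : tens := tens_mk (tens_repr t ++ tens_repr u).
Definition tens_scale (a : k) (t : tens) : tens :=
  tens_mk [seq (a *: p.1, p.2) | p <- tens_repr t].

Section Lift.
Variables (E : lmodType k) (B : {bilinear V -> W -> E}).

Lemma tens_lift_pure v w : tens_lift B (tens_pure v w) = B v w.
Proof. by rewrite tens_lift_mk /tens_eval big_seq1. Qed.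

Lemma tens_lift_zero : tens_lift B tens_zero = 0.
Proof. by rewrite tens_lift_mk /tens_eval big_nil. Qed.

Lemma tens_lift_add t u :
  tens_lift B (tens_add t u) = tens_lift B t + tens_lift B u.
Proof. by rewrite tens_lift_mk /tens_eval big_cat. Qed.

Lemma tens_lift_scale a t : tens_lift B (tens_scale a t) = a *: tens_lift B t.
Proof.
rewrite tens_lift_mk /tens_eval big_map scaler_sumr.
by apply: eq_bigr => p _; rewrite /= linearZl_LR.
Qed.

End Lift.

Fact tens_addA : associative tens_add.
Proof. by move=> t u v; apply: tens_ext => E B; rewrite !tens_lift_add addrA. Qed.
Fact tens_addC : commutative tens_add.
Proof. by move=> t u; apply: tens_ext => E B; rewrite !tens_lift_add addrC. Qed.
Fact tens_add0 : left_id tens_zero tens_add.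
Proof.
by move=> t; apply: tens_ext => E B; rewrite tens_lift_add tens_lift_zero add0r.
Qed.
Fact tens_addN : left_inverse tens_zero (tens_scale (-1)) tens_add.
Proof.
move=> t; apply: tens_ext => E B.
by rewrite tens_lift_add tens_lift_zero tens_lift_scale scaleN1r addNr.
Qed.

HB.instance Definition _ :=
  GRing.isZmodule.Build tens tens_addA tens_addC tens_add0 tens_addN.

Fact tens_scaleA a b t : tens_scale a (tens_scale b t) = tens_scale (a * b) t.
Proof. by apply: tens_ext => E B; rewrite !tens_lift_scale scalerA. Qed.
Fact tens_scale1 : left_id 1 tens_scale.
Proof. by move=> t; apply: tens_ext => E B; rewrite tens_lift_scale scale1r. Qed.
Fact tens_scaleDr : right_distributive tens_scale +%R.
Proof.
by move=> a t u; apply: tens_ext => E B;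
   rewrite !(tens_lift_add, tens_lift_scale) scalerDr.
Qed.
Fact tens_scaleDl t : {morph tens_scale^~ t : a b / a + b}.
Proof.
by move=> a b; apply: tens_ext => E B;
   rewrite !(tens_lift_add, tens_lift_scale) scalerDl.
Qed.

HB.instance Definition _ := GRing.Zmodule_isLmodule.Build k tens
  tens_scaleA tens_scale1 tens_scaleDr tens_scaleDl.

Fact tens_lift_linear (E : lmodType k) (B : {bilinear V -> W -> E}) :
  linear (tens_lift B).
Proof. by move=> a t u; rewrite tens_lift_add tens_lift_scale. Qed.

HB.instance Definition _ (E : lmodType k) (B : {bilinear V -> W -> E}) :=
  GRing.isLinear.Build k tens E *:%R (tens_lift B) (tens_lift_linear B).

Fact tens_pure_linearl (w : W) : linear (tens_pure^~ w).
Proof.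
move=> a u v; apply: tens_ext => E B.
by rewrite linearP /= !tens_lift_pure linearPl.
Qed.

Fact tens_pure_linearr (v : V) : linear (tens_pure v).
Proof.
move=> a u w; apply: tens_ext => E B.
by rewrite linearP /= !tens_lift_pure linearPr.
Qed.

HB.instance Definition _ := isBilinear.Build k V W tens *:%R *:%R tens_pure
  (fun w => zmod_morphism_linear (tens_pure_linearl w))
  (fun v => zmod_morphism_linear (tens_pure_linearr v))
  (fun w => scalable_linear (tens_pure_linearl w))
  (fun v => scalable_linear (tens_pure_linearr v)).

Lemma tens_span (t : tens) :
  exists s : seq (V * W), t = \sum_(p <- s) tens_pure p.1 p.2.
Proof.
exists (tens_repr t); apply: tens_ext => E B; rewrite linear_sum /=.
by under [RHS]eq_bigr do rewrite tens_lift_pure.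
Qed.

End Tensor.

Section TensorMul.
Variables (k : fieldType) (A A' : algType k).
Local Notation T := (tens A A').

Definition tens_one : T := tens_pure 1 1.
Definition tens_mul (t u : T) : T :=
  tens_mk [seq (p.1 * q.1, p.2 * q.2) | p <- tens_repr t, q <- tens_repr u].

Section Shift.
Variables (E : lmodType k) (B : {bilinear A -> A' -> E}).

Definition mul_shiftr c d a b : E := B (a * c) (b * d).
Definition mul_shiftl c d a b : E := B (c * a) (d * b).

Fact mul_shiftr_linearl c d b : linear (mul_shiftr c d ^~ b).
Proof. by move=> x u v; rewrite /mul_shiftr mulrDl -scalerAl linearPl. Qed.
Fact mul_shiftr_linearr c d a : linear (mul_shiftr c d a).
Proof. by move=> x u v; rewrite /mul_shiftr mulrDl -scalerAl linearPr. Qed.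
Fact mul_shiftl_linearl c d b : linear (mul_shiftl c d ^~ b).
Proof. by move=> x u v; rewrite /mul_shiftl mulrDr -scalerAr linearPl. Qed.
Fact mul_shiftl_linearr c d a : linear (mul_shiftl c d a).
Proof. by move=> x u v; rewrite /mul_shiftl mulrDr -scalerAr linearPr. Qed.

HB.instance Definition _ c d :=
  isBilinear.Build k A A' E *:%R *:%R (mul_shiftr c d)
  (fun w => zmod_morphism_linear (mul_shiftr_linearl c d w))
  (fun v => zmod_morphism_linear (mul_shiftr_linearr c d v))
  (fun w => scalable_linear (mul_shiftr_linearl c d w))
  (fun v => scalable_linear (mul_shiftr_linearr c d v)).
HB.instance Definition _ c d :=
  isBilinear.Build k A A' E *:%R *:%R (mul_shiftl c d)
  (fun w => zmod_morphism_linear (mul_shiftl_linearl c d w))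
  (fun v => zmod_morphism_linear (mul_shiftl_linearr c d v))
  (fun w => scalable_linear (mul_shiftl_linearl c d w))
  (fun v => scalable_linear (mul_shiftl_linearr c d v)).

End Shift.

Section LiftMul.
Variables (E : lmodType k) (B : {bilinear A -> A' -> E}).

Lemma tens_lift_mulr t u : tens_lift B (tens_mul t u) =
  \sum_(q <- tens_repr u) tens_lift (mul_shiftr B q.1 q.2) t.
Proof. by rewrite tens_lift_mk /tens_eval big_allpairs_dep exchange_big. Qed.

Lemma tens_lift_mull t u : tens_lift B (tens_mul t u) =
  \sum_(p <- tens_repr t) tens_lift (mul_shiftl B p.1 p.2) u.
Proof. by rewrite tens_lift_mk /tens_eval big_allpairs_dep. Qed.

End LiftMul.

Fact tens_mulDl : left_distributive tens_mul +%R.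
Proof.
move=> t u v; apply: tens_ext => E B; rewrite linearD /= !tens_lift_mulr -big_split /=.
by apply: eq_bigr => q _; rewrite linearD.
Qed.

Fact tens_mulDr : right_distributive tens_mul +%R.
Proof.
move=> t u v; apply: tens_ext => E B; rewrite linearD /= !tens_lift_mull -big_split /=.
by apply: eq_bigr => q _; rewrite linearD.
Qed.

Fact tens_scaleAl a (t u : T) : a *: tens_mul t u = tens_mul (a *: t) u.
Proof.
apply: tens_ext => E B; rewrite linearZ /= !tens_lift_mulr scaler_sumr.
by apply: eq_bigr => q _; rewrite linearZ.
Qed.

Fact tens_scaleAr a (t u : T) : a *: tens_mul t u = tens_mul t (a *: u).
Proof.
apply: tens_ext => E B; rewrite linearZ /= !tens_lift_mull scaler_sumr.
by apply: eq_bigr => q _; rewrite linearZ.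
Qed.

Fact tens_mul_pure a b c d :
  tens_mul (tens_pure a b) (tens_pure c d) = tens_pure (a * c) (b * d).
Proof.
apply: tens_ext => E B; rewrite tens_lift_mulr tens_lift_pure.
under eq_bigr do rewrite tens_lift_pure.
exact: (tens_lift_pure (mul_shiftl B a b) c d).
Qed.

Fact tens_mulA : associative tens_mul.
Proof.
have sumr I (r : seq I) (F : I -> T) t :
    tens_mul t (\sum_(i <- r) F i) = \sum_(i <- r) tens_mul t (F i).
  elim/big_rec2: _ => [|i y1 y2 _ <-]; last by rewrite tens_mulDr.
  by rewrite -[0 in LHS](scale0r 0) -tens_scaleAr scale0r.
have suml I (r : seq I) (F : I -> T) t :
    tens_mul (\sum_(i <- r) F i) t = \sum_(i <- r) tens_mul (F i) t.
  elim/big_rec2: _ => [|i y1 y2 _ <-]; last by rewrite tens_mulDl.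
  by rewrite -[0 in LHS](scale0r 0) -tens_scaleAl scale0r.
move=> t u v.
have [s ->] := tens_span t; have [s' ->] := tens_span u.
have [s'' ->] := tens_span v.
rewrite !suml; apply: eq_bigr => p _.
rewrite sumr [X in _ = tens_mul X _]sumr suml; apply: eq_bigr => q _.
rewrite !sumr; apply: eq_bigr => r _.
by rewrite !tens_mul_pure !mulrA.
Qed.

Fact tens_mul1 : left_id tens_one tens_mul.
Proof.
move=> t; apply: tens_ext => E B; rewrite tens_lift_mulr.
by apply: eq_bigr => q _; rewrite tens_lift_pure /= /mul_shiftr !mul1r.
Qed.

Fact tens_mulr1 : right_id tens_one tens_mul.
Proof.
move=> t; apply: tens_ext => E B; rewrite tens_lift_mull.
by apply: eq_bigr => q _; rewrite tens_lift_pure /= /mul_shiftl !mulr1.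
Qed.

End TensorMul.

(** [uea g] is the quotient of the tensor algebra of [g], whose elements are
    written as lists of coefficients and words, identifying two elements when
    every Lie morphism from [g] to an associative unital algebra takes them to
    the same value.  [uea_lift], [uea_liftE] and [uea_lift_uniq] state the
    universal property. *)

Record lieHom (k : fieldType) (g : lieAlg k) (A : algType k) := LieHom {
  lie_fun :> {linear g -> A};
  lie_homP : forall x y : g,
    lie_fun (lie_bracket g x y) = lie_fun x * lie_fun y - lie_fun y * lie_fun x
}.

Section EnvelopingAlgebra.
Variables (k : fieldType) (g : lieAlg k).

Definition word_eval (A : algType k) (f : g -> A) (t : seq (k * seq g)) : A :=
  \sum_(p <- t) p.1 *: \prod_(x <- p.2) f x.

Definition uea_rel : rel (seq (k * seq g)) := fun t u =>
  `[< forall (A : algType k) (f : lieHom g A), word_eval f t = word_eval f u >].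

Fact uea_rel_refl : reflexive uea_rel.
Proof. by move=> t; apply/asboolP. Qed.

Fact uea_rel_sym : symmetric uea_rel.
Proof. by move=> t u; apply/asboolP/asboolP => tu A f. Qed.

Fact uea_rel_trans : transitive uea_rel.
Proof. by move=> t u v /asboolP ut /asboolP tv; apply/asboolP => A f; rewrite ut. Qed.

Canonical uea_equiv := EquivRel uea_rel uea_rel_refl uea_rel_sym uea_rel_trans.

Definition uea : Type := {eq_quot uea_equiv}.

HB.instance Definition _ := Choice.on uea.

Definition uea_mk (t : seq (k * seq g)) : uea := \pi_({eq_quot uea_equiv}) t.
Definition uea_repr (t : uea) : seq (k * seq g) := @repr _ {eq_quot uea_equiv} t.

Definition uea_lift (A : algType k) (f : lieHom g A) (u : uea) : A :=
  word_eval f (uea_repr u).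

Lemma uea_lift_mk (A : algType k) (f : lieHom g A) t :
  uea_lift f (uea_mk t) = word_eval f t.
Proof.
suff /eqmodP/asboolP : uea_repr (uea_mk t) = t %[mod {eq_quot uea_equiv}] by exact.
by rewrite /uea_repr reprK.
Qed.

Lemma uea_ext (t u : uea) :
  (forall (A : algType k) (f : lieHom g A), uea_lift f t = uea_lift f u) -> t = u.
Proof.
move=> tu; rewrite -[t]reprK -[u]reprK; apply/eqmodP/asboolP => A f.
exact: tu.
Qed.

Definition uea_zero : uea := uea_mk [::].
Definition uea_one : uea := uea_mk [:: (1, [::])].
Definition uea_add (t u : uea) : uea := uea_mk (uea_repr t ++ uea_repr u).
Definition uea_scale (a : k) (t : uea) : uea :=
  uea_mk [seq (a * p.1, p.2) | p <- uea_repr t].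
Definition uea_mul (t u : uea) : uea :=
  uea_mk [seq (p.1 * q.1, p.2 ++ q.2) | p <- uea_repr t, q <- uea_repr u].
Definition uea_in (x : g) : uea := uea_mk [:: (1, [:: x])].

Section Lift.
Variables (A : algType k) (f : lieHom g A).

Lemma uea_liftE x : uea_lift f (uea_in x) = f x.
Proof. by rewrite uea_lift_mk /word_eval !big_seq1 scale1r. Qed.

Lemma uea_lift_zero : uea_lift f uea_zero = 0.
Proof. by rewrite uea_lift_mk /word_eval big_nil. Qed.

Lemma uea_lift_one : uea_lift f uea_one = 1.
Proof. by rewrite uea_lift_mk /word_eval big_seq1 big_nil scale1r. Qed.

Lemma uea_lift_add t u : uea_lift f (uea_add t u) = uea_lift f t + uea_lift f u.
Proof. by rewrite uea_lift_mk /word_eval big_cat. Qed.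

Lemma uea_lift_scale a t : uea_lift f (uea_scale a t) = a *: uea_lift f t.
Proof.
rewrite uea_lift_mk /word_eval big_map scaler_sumr.
by apply: eq_bigr => p _; rewrite scalerA.
Qed.

Lemma uea_lift_mul t u : uea_lift f (uea_mul t u) = uea_lift f t * uea_lift f u.
Proof.
rewrite uea_lift_mk /word_eval big_allpairs_dep mulr_suml.
apply: eq_bigr => p _; rewrite mulr_sumr; apply: eq_bigr => q _.
by rewrite big_cat -scalerAr -scalerAl scalerA mulrC.
Qed.

End Lift.

Let liftE := (uea_lift_zero, uea_lift_one, uea_lift_add, uea_lift_scale, uea_lift_mul).

Fact uea_addA : associative uea_add.
Proof. by move=> t u v; apply: uea_ext => A f; rewrite !liftE addrA. Qed.
Fact uea_addC : commutative uea_add.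
Proof. by move=> t u; apply: uea_ext => A f; rewrite !liftE addrC. Qed.
Fact uea_add0 : left_id uea_zero uea_add.
Proof. by move=> t; apply: uea_ext => A f; rewrite !liftE add0r. Qed.
Fact uea_addN : left_inverse uea_zero (uea_scale (-1)) uea_add.
Proof. by move=> t; apply: uea_ext => A f; rewrite !liftE scaleN1r addNr. Qed.

HB.instance Definition _ :=
  GRing.isZmodule.Build uea uea_addA uea_addC uea_add0 uea_addN.

Fact uea_mulA : associative uea_mul.
Proof. by move=> t u v; apply: uea_ext => A f; rewrite !liftE mulrA. Qed.
Fact uea_mul1 : left_id uea_one uea_mul.
Proof. by move=> t; apply: uea_ext => A f; rewrite !liftE mul1r. Qed.
Fact uea_mulr1 : right_id uea_one uea_mul.
Proof. by move=> t; apply: uea_ext => A f; rewrite !liftE mulr1. Qed.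
Fact uea_mulDl : left_distributive uea_mul +%R.
Proof. by move=> t u v; apply: uea_ext => A f; rewrite !liftE mulrDl. Qed.
Fact uea_mulDr : right_distributive uea_mul +%R.
Proof. by move=> t u v; apply: uea_ext => A f; rewrite !liftE mulrDr. Qed.

Fact zero_lieP (x y : g) :
  (\0 : {linear g -> k^o}) (lie_bracket g x y)
    = (\0 : {linear g -> k^o}) x * (\0 : {linear g -> k^o}) y
      - (\0 : {linear g -> k^o}) y * (\0 : {linear g -> k^o}) x.
Proof. by rewrite /= mulr0 subrr. Qed.

Definition zero_lieHom : lieHom g k^o := LieHom zero_lieP.

Fact uea_one_neq0 : uea_one != 0 :> uea.
Proof.
apply/eqP => /(congr1 (uea_lift zero_lieHom)) /eqP.
by rewrite uea_lift_one uea_lift_zero oner_eq0.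
Qed.

HB.instance Definition _ := GRing.Zmodule_isNzRing.Build uea
  uea_mulA uea_mul1 uea_mulr1 uea_mulDl uea_mulDr uea_one_neq0.

Fact uea_scaleA a b t : uea_scale a (uea_scale b t) = uea_scale (a * b) t.
Proof. by apply: uea_ext => A f; rewrite !liftE scalerA. Qed.
Fact uea_scale1 : left_id 1 uea_scale.
Proof. by move=> t; apply: uea_ext => A f; rewrite !liftE scale1r. Qed.
Fact uea_scaleDr : right_distributive uea_scale +%R.
Proof. by move=> a t u; apply: uea_ext => A f; rewrite !liftE scalerDr. Qed.
Fact uea_scaleDl t : {morph uea_scale^~ t : a b / a + b}.
Proof. by move=> a b; apply: uea_ext => A f; rewrite !liftE scalerDl. Qed.

HB.instance Definition _ := GRing.Zmodule_isLmodule.Build k uea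
  uea_scaleA uea_scale1 uea_scaleDr uea_scaleDl.

Fact uea_scaleAl (a : k) (t u : uea) : a *: (t * u) = (a *: t) * u.
Proof. by apply: uea_ext => A f; rewrite !liftE scalerAl. Qed.
Fact uea_scaleAr (a : k) (t u : uea) : a *: (t * u) = t * (a *: u).
Proof. by apply: uea_ext => A f; rewrite !liftE scalerAr. Qed.

HB.instance Definition _ := GRing.Lmodule_isLalgebra.Build k uea uea_scaleAl.
HB.instance Definition _ := GRing.Lalgebra_isAlgebra.Build k uea uea_scaleAr.

Fact uea_lift_linear (A : algType k) (f : lieHom g A) : linear (uea_lift f).
Proof. by move=> a t u; rewrite uea_lift_add uea_lift_scale. Qed.

Fact uea_lift_monoid (A : algType k) (f : lieHom g A) :
  monoid_morphism (uea_lift f).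
Proof. by split; [exact: uea_lift_one | exact: uea_lift_mul]. Qed.

HB.instance Definition _ (A : algType k) (f : lieHom g A) :=
  GRing.isLinear.Build k uea A *:%R (uea_lift f) (uea_lift_linear f).
HB.instance Definition _ (A : algType k) (f : lieHom g A) :=
  GRing.isMonoidMorphism.Build uea A (uea_lift f) (uea_lift_monoid f).

Fact uea_in_linear : linear uea_in.
Proof.
by move=> a x y; apply: uea_ext => A f; rewrite linearP /= !uea_liftE linearP.
Qed.

HB.instance Definition _ := GRing.isLinear.Build k g uea *:%R uea_in uea_in_linear.

Fact uea_in_lieP (x y : g) :
  uea_in (lie_bracket g x y) = uea_in x * uea_in y - uea_in y * uea_in x.
Proof.
apply: uea_ext => A f.
by rewrite linearB /= !rmorphM /= !uea_liftE lie_homP.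
Qed.

Definition uea_in_lieHom : lieHom g uea := LieHom uea_in_lieP.

Lemma uea_span (u : uea) :
  exists s : seq (k * seq g), u = \sum_(p <- s) p.1 *: \prod_(x <- p.2) uea_in x.
Proof.
exists (uea_repr u); apply: uea_ext => A f; rewrite linear_sum /=.
under [RHS]eq_bigr => p _.
  rewrite linearZ /= rmorph_prod /=.
  under eq_bigr do rewrite uea_liftE.
  over.
by [].
Qed.

Lemma uea_lift_uniq (A : algType k) (f : lieHom g A) (h : {lrmorphism uea -> A}) :
  (forall x, h (uea_in x) = f x) -> h =1 uea_lift f.
Proof.
move=> hf u; have [s ->] := uea_span u; rewrite !linear_sum.
apply: eq_bigr => p _; rewrite !linearZ /= !rmorph_prod /=.
by congr (_ *: _); apply: eq_bigr => x _; rewrite hf uea_liftE.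
Qed.

Definition uea_counit : uea -> k^o := uea_lift zero_lieHom.
HB.instance Definition _ := GRing.LRMorphism.on uea_counit.

Definition counit2 (u v : uea) : k^o := uea_counit u * uea_counit v.
Fact counit2_linearl v : linear (counit2^~ v).
Proof. by move=> a x y; rewrite /counit2 linearP /= mulrDl -scalerAl. Qed.
Fact counit2_linearr u : linear (counit2 u).
Proof. by move=> a x y; rewrite /counit2 linearP /= mulrDr -scalerAr. Qed.
HB.instance Definition _ := isBilinear.Build k uea uea k^o *:%R *:%R counit2
  (fun w => zmod_morphism_linear (counit2_linearl w))
  (fun v => zmod_morphism_linear (counit2_linearr v))
  (fun w => scalable_linear (counit2_linearl w))
  (fun v => scalable_linear (counit2_linearr v)).

Fact tens_one_neq0 : tens_one uea uea != 0.
Proof.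
apply/eqP => /(congr1 (tens_lift counit2)) /eqP.
by rewrite tens_lift_pure linear0 /= /counit2 !rmorph1 mulr1 oner_eq0.
Qed.

Definition uea2 : Type := tens uea uea.
HB.instance Definition _ := GRing.Lmodule.on uea2.
HB.instance Definition _ := GRing.Zmodule_isNzRing.Build uea2
  (@tens_mulA _ uea uea) (@tens_mul1 _ uea uea) (@tens_mulr1 _ uea uea)
  (@tens_mulDl _ uea uea) (@tens_mulDr _ uea uea) tens_one_neq0.
HB.instance Definition _ :=
  GRing.Lmodule_isLalgebra.Build k uea2 (@tens_scaleAl _ uea uea).
HB.instance Definition _ :=
  GRing.Lalgebra_isAlgebra.Build k uea2 (@tens_scaleAr _ uea uea).

Definition primitive (x : g) : uea2 :=
  tens_pure (uea_in x) 1 + tens_pure 1 (uea_in x).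

Fact primitive_linear : linear primitive.
Proof.
move=> a x y; rewrite /primitive linearP linearPl linearPr /=.
by rewrite scalerDr addrACA.
Qed.

HB.instance Definition _ :=
  GRing.isLinear.Build k g uea2 *:%R primitive primitive_linear.

Fact primitive_lieP (x y : g) : primitive (lie_bracket g x y)
  = primitive x * primitive y - primitive y * primitive x.
Proof.
rewrite /primitive uea_in_lieP linearBl linearBr /=.
have mulE a b c d : (tens_pure a b : uea2) * tens_pure c d
  = tens_pure (a * c) (b * d) by exact: tens_mul_pure.
rewrite !mulrDl !mulrDr !mulE !mulr1 !mul1r !opprD.
rewrite [RHS](AC ((2*2)*(2*2)) ((1*5)*(4*8)*((2*7)*(3*6)))) /=.
by rewrite !subrr !addr0.
Qed.

Definition uea_coprod : uea -> uea2 := uea_lift (LieHom primitive_lieP).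
HB.instance Definition _ := GRing.LRMorphism.on uea_coprod.

End EnvelopingAlgebra.

Section GuinOudom.
Variables (k : fieldType) (g : postLieAlg k).
Local Notation U := (uea g).

(* Monomials span [U], so at most one bilinear map satisfies this. *)
Record is_tri_extension (tri : {bilinear U -> U -> U}) : Prop := IsTriExtension {
  tri_unitr : forall x : g, tri (uea_in x) 1 = 0;
  tri_prodr : forall (x : g) r (y : 'I_r -> g),
    tri (uea_in x) (\prod_(j < r) uea_in (y j))
      = \sum_(i < r) \prod_(j < r)
          uea_in (if j == i then pl_tri g x (y j) else y j);
  tri_unitl : forall u : U, tri 1 u = u;
  tri_prodl : forall (x : g) (s : seq g) (u : U),
    tri (uea_in x * \prod_(y <- s) uea_in y) u
      = tri (uea_in x) (tri (\prod_(y <- s) uea_in y) u)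
        - tri (tri (uea_in x) (\prod_(y <- s) uea_in y)) u
}.

Variable tri : {bilinear U -> U -> U}.

Definition circ_sweedler (v a b : U) : U := a * tri b v.

Fact circ_sweedler_linearl v b : linear (circ_sweedler v ^~ b).
Proof. by move=> c x y; rewrite /circ_sweedler mulrDl -scalerAl. Qed.

Fact circ_sweedler_linearr v a : linear (circ_sweedler v a).
Proof. by move=> c x y; rewrite /circ_sweedler linearPl mulrDr -scalerAr. Qed.

HB.instance Definition _ v :=
  isBilinear.Build k U U U *:%R *:%R (circ_sweedler v)
  (fun w => zmod_morphism_linear (circ_sweedler_linearl v w))
  (fun u => zmod_morphism_linear (circ_sweedler_linearr v u))
  (fun w => scalable_linear (circ_sweedler_linearl v w))
  (fun u => scalable_linear (circ_sweedler_linearr v u)).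

(* [u_1 (u_2 |> v)] in Sweedler notation *)
Definition circ (u v : U) : U := tens_lift (circ_sweedler v) (uea_coprod u).

Definition is_guin_oudom (phi : {linear uea (sub_adjacent g) -> U}) : Prop :=
  forall s : seq g,
    phi (\prod_(x <- s) @uea_in k (sub_adjacent g) x)
      = \big[circ/1]_(x <- s) uea_in x.

End GuinOudom.

Section Nesting.
Variables (I : eqType) (T : Type) (op : T -> T -> T).

(* An entry carries the indices of the formal symbols occurring in it. *)
Fixpoint merge_right (i : I) (s : seq (seq I * T)) : seq (seq I * T) :=
  if s is a :: s' then
    if i \in a.1 then
      if s' is c :: s'' then (a.1 ++ c.1, op a.2 c.2) :: s'' else s
    else a :: merge_right i s'
  else [::].

Definition merge_all (s : seq (seq I * T)) (order : seq I) : seq (seq I * T) :=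
  foldl (fun s i => merge_right i s) s order.

End Nesting.

Section Brackets.
Variables (k : fieldType) (g : postLieAlg k).

(* The word of [w] is [w ord0, ..., w ord_max]; the final sequence has exactly
   one entry. *)
Definition perm_bracket r (x : 'I_r -> g) (y : g) (w : 'S_r) : g :=
  let start := rcons [seq ([:: w i], x (w i)) | i <- enum 'I_r] ([::], y) in
  (head ([::], 0) (merge_all (pl_tri g) start (enum 'I_r))).2.

(* [enum I] is increasing; the defaults are not reached when [I] is nonempty. *)
Definition block_bracket n (x : 'I_n -> g) (I : {set 'I_n}) : g :=
  let s := [seq x i | i <- enum I] in
  \sum_(w : 'S_(#|I|.-1)) perm_bracket (fun j => nth 0 s j) (last 0 s) w.

End Brackets.

Definition blocks_by_max n (P : {set {set 'I_n}}) : seq {set 'I_n} :=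
  sort (fun B C : {set 'I_n} => (\max_(i in B) i <= \max_(i in C) i)%N) (enum P).

(* Main.v *)
(** If [x] is primitive then [x o v = x v + x |> v], hence
      [phi^-1 (x v) = x phi^-1 v - phi^-1 (x |> v)].
    Apply this to [x_a v], where [a] is the least index and [v] is the product
    of the other [x_i]: [x_a |> v] is a sum over [i > a] of products in which
    [x_i] is replaced by [x_a |> x_i].  By induction each of them is a sum over
    partitions [Q] of the indices other than [a].  The first term gives the
    partitions in which [{a}] is a block.  For the second, if [B] is the block
    of [Q] containing [i], summing [[x_B]] with [x_i] so replaced over [i] in
    [B] gives [[x_(a |: B)]], since the first contraction in a nested bracket
    joins [x_a] to its right neighbour; this gives the partitions in which the
    block of [a] is [a |: B], and the order of the blocks by their maxima is
    unchanged. *)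

Require Import Defs.
From mathcomp Require Import all_boot perm all_algebra.
From mathcomp Require Import sesquilinear.
From mathcomp Require Import boolp.

Set Implicit Arguments.
Unset Strict Implicit.
Unset Printing Implicit Defensive.

Import GRing.Theory.
Local Open Scope ring_scope.

(** * Nested brackets *)

Section Nesting.
Variables (T : Type) (op : T -> T -> T).

Lemma merge_right_cat (I : eqType) (i : I) (s1 s2 : seq (seq I * T)) :
  all (fun a => i \notin a.1) s1 ->
  merge_right op i (s1 ++ s2) = s1 ++ merge_right op i s2.
Proof. by elim: s1 => //= a s1 IH /andP[/negPf-> /IH ->]. Qed.

(* [ord0] can be forgotten once its contraction has been performed. *)
Definition unlift_entry r (a : seq 'I_r.+1 * T) : seq 'I_r * T :=
  (pmap (unlift ord0) a.1, a.2).

Lemma mem_pmap_unlift r (h : 'I_r.+1) j (l : seq 'I_r.+1) :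
  (j \in pmap (unlift h) l) = (lift h j \in l).
Proof.
elim: l => //= i l IH; rewrite inE; case: unliftP => [i'|] -> /=.
  by rewrite inE IH (inj_eq lift_inj).
by rewrite IH eq_sym (negPf (neq_lift _ _)).
Qed.

(** A contraction only asks which entry holds its symbol, and forgetting [ord0] does not change the
    answer for [lift ord0 j]. *)
Lemma merge_right_unlift r (j : 'I_r) (s : seq (seq 'I_r.+1 * T)) :
  map (@unlift_entry r) (merge_right op (lift ord0 j) s)
  = merge_right op j (map (@unlift_entry r) s).
Proof.
elim: s => //= a s IH; rewrite mem_pmap_unlift; case: ifP => _; last by rewrite -IH.
by case: s {IH} => //= c s; rewrite {1}/unlift_entry /= pmap_cat.
Qed.

Lemma merge_all_unlift r (l : seq 'I_r) (s : seq (seq 'I_r.+1 * T)) :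
  map (@unlift_entry r) (merge_all op s (map (lift ord0) l))
  = merge_all op (map (@unlift_entry r) s) l.
Proof. by elim: l s => //= j l IH s; rewrite IH merge_right_unlift. Qed.

End Nesting.

(** * Words of permutations *)

Lemma enum_ord_lift r (p : 'I_r.+1) :
  enum 'I_r.+1 = take p (map (lift p) (enum 'I_r))
                   ++ p :: drop p (map (lift p) (enum 'I_r)).
Proof.
apply: (inj_map val_inj); rewrite val_enum_ord map_cat /= map_take map_drop.
have le_pr : (p <= r)%N by rewrite -ltnS.
have -> : map val (map (lift p) (enum 'I_r)) = map (bump p) (iota 0 r).
  by rewrite -val_enum_ord -!map_comp.
move: (nat_of_ord p) le_pr => {}p le_pr.
rewrite -{2 3}(subnKC le_pr) iotaD map_cat add0n.
rewrite take_size_cat ?drop_size_cat ?size_map ?size_iota //.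
rewrite -[_ :: iota 1 r]/(iota 0 r.+1) -{1}(subnKC le_pr) -addnS iotaD add0n /=; congr (_ ++ _ :: _).
  rewrite -[LHS]map_id; apply/eq_in_map => i; rewrite mem_iota add0n => /= ip.
  by rewrite /bump leqNgt ip.
rewrite -[in LHS]addn1 addnC iotaDl.
by apply/eq_in_map => i; rewrite mem_iota => /andP[pi _]; rewrite /bump pi.
Qed.

(** Cutting the enumeration at [p] exhibits the word of [lift_perm p q s] as that of [s], shifted by
    [lift q], with the letter [q] inserted at position [p]. *)
Lemma map_lift_perm r (p q : 'I_r.+1) (s : 'S_r) :
  map (lift_perm p q s) (enum 'I_r.+1)
  = take p (map (lift q) (map s (enum 'I_r)))
      ++ q :: drop p (map (lift q) (map s (enum 'I_r))).
Proof.
rewrite (enum_ord_lift p) map_cat /= map_take map_drop lift_perm_id.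
suff -> : map (lift_perm p q s) (map (lift p) (enum 'I_r))
        = map (lift q) (map s (enum 'I_r)) by [].
by rewrite -!map_comp; apply: eq_map => i /=; rewrite lift_perm_lift.
Qed.

(** Here [p] is the position of the letter [ord0] in the word of [w], and [s] is what remains once
    it is deleted. Injectivity suffices, since the cardinalities agree. *)
Lemma sum_lift_perm (V : nmodType) r (F : 'S_r.+1 -> V) :
  \sum_(w : 'S_r.+1) F w
  = \sum_(p < r.+1) \sum_(s : 'S_r) F (lift_perm p ord0 s).
Proof.
rewrite pair_bigA /=.
rewrite (reindex (fun u : 'I_r.+1 * 'S_r => lift_perm u.1 ord0 u.2)) //=.
apply/onW_bij/inj_card_bij; last first.
  by rewrite card_prod card_ord !card_Sn factS.
move=> [p s] [q t] /= E.
have Epq : p = q.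
  apply: (@perm_inj _ (lift_perm p ord0 s)); rewrite lift_perm_id E.
  by rewrite lift_perm_id.
rewrite -{}Epq in E *; congr (_, _); apply/permP => i.
apply: (@lift_inj _ ord0).
by rewrite -(lift_perm_lift p) E lift_perm_lift.
Qed.

(** Both lists are strictly increasing and have the same elements. *)
Lemma enum_setU1 n (a : 'I_n) (B : {set 'I_n}) : {in B, forall i : 'I_n, (a < i)%N} ->
  enum (a |: B) = a :: enum B.
Proof.
move=> aB; have tr : transitive (fun i j : 'I_n => (i < j)%N).
  by move=> ? ? ?; exact: ltn_trans.
have aS (C : {set 'I_n}) : sorted (fun i j : 'I_n => (i < j)%N) (enum C).
  rewrite {1}/enum_mem; apply: sorted_filter => //.
  by have := iota_ltn_sorted 0 n; rewrite -val_enum_ord sorted_map enumT.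
apply: (@irr_sorted_eq _ _ tr) => //.
- by move=> i; rewrite /= ltnn.
- rewrite /= path_min_sorted //; apply/allP => i; rewrite mem_enum; exact: aB.
- by move=> i; rewrite !(inE, mem_enum).
Qed.

(** * Recursion for the brackets *)

Section Brackets.
Variables (k : fieldType) (g : postLieAlg k).
Local Notation tri := (pl_tri g).

(** The word is an arbitrary list of letters, so that the word of a permutation can be cut into
    pieces. *)
Definition word_entries r (x : 'I_r -> g) (y : g) (t : seq 'I_r) :=
  rcons [seq ([:: i], x i) | i <- t] ([::], y).

Lemma perm_bracketE r (x : 'I_r -> g) y w : perm_bracket x y w =
  (head ([::], 0)
    (merge_all tri (word_entries x y (map w (enum 'I_r))) (enum 'I_r))).2.
Proof. by rewrite /perm_bracket /word_entries -(map_comp _ w). Qed.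

Lemma word_entries_cat r (x : 'I_r -> g) y t1 t2 :
  word_entries x y (t1 ++ t2) = [seq ([:: i], x i) | i <- t1] ++ word_entries x y t2.
Proof. by rewrite /word_entries map_cat rcons_cat. Qed.

Lemma map_unlift_entry_lift r (x : 'I_r.+1 -> g) (t : seq 'I_r) :
  map (@unlift_entry g r) [seq ([:: i], x i) | i <- map (lift ord0) t]
  = [seq ([:: i], x (lift ord0 i)) | i <- t].
Proof.
by rewrite -!map_comp; apply: eq_map => i; rewrite /unlift_entry /= liftK.
Qed.

Lemma unlift_word_entries_lift r (x : 'I_r.+1 -> g) y (t : seq 'I_r) :
  map (@unlift_entry g r) (word_entries x y (map (lift ord0) t))
  = word_entries (fun i => x (lift ord0 i)) y t.
Proof. by rewrite /word_entries map_rcons map_unlift_entry_lift. Qed.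

Lemma ord0_notin_entries r (x : 'I_r.+1 -> g) (t : seq 'I_r) :
  all (fun a => ord0 \notin a.1) [seq ([:: i], x i) | i <- map (lift ord0) t].
Proof. by elim: t => //= i t ->; rewrite inE neq_lift. Qed.

(** The first contraction is that of [ord0]; the later ones never look for [ord0], so they may run
    after it is erased. *)
Lemma merge_all_ordS r (s : seq (seq 'I_r.+1 * g)) :
  (head ([::], 0) (merge_all tri s (enum 'I_r.+1))).2
  = (head ([::], 0) (merge_all tri
      (map (@unlift_entry g r) (merge_right tri ord0 s)) (enum 'I_r))).2.
Proof.
rewrite enum_ordSl [LHS]/= -merge_all_unlift.
by case: (merge_all _ _ _) => [|a s'].
Qed.

Lemma perm_bracket_lift_max r (x : 'I_r.+1 -> g) y (s : 'S_r) :
  perm_bracket x y (lift_perm ord_max ord0 s)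
  = perm_bracket (fun j => x (lift ord0 j)) (tri (x ord0) y) s.
Proof.
rewrite !perm_bracketE merge_all_ordS map_lift_perm.
rewrite take_oversize ?drop_oversize ?size_map -?enumT ?size_enum_ord //.
rewrite word_entries_cat merge_right_cat ?ord0_notin_entries //=.
rewrite map_cat map_unlift_entry_lift /= /word_entries cats1.
(* The merged last entry holds only [ord0], hence no symbol once [ord0] is forgotten, as a last
   entry should. *)
by rewrite /unlift_entry /= unlift_none.
Qed.

(** The right neighbour of an [ord0] inserted at position [p] is the letter [s p]. The merged entry
    holds [s p] alone once [ord0] is forgotten, so a bracket for [s] with one entry changed
    remains. *)
Lemma perm_bracket_lift r (x : 'I_r.+1 -> g) y (p : 'I_r) (s : 'S_r) :
  perm_bracket x y (lift_perm (widen_ord (leqnSn r) p) ord0 s)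
  = perm_bracket (fun j => if j == s p then tri (x ord0) (x (lift ord0 j))
                           else x (lift ord0 j)) y s.
Proof.
rewrite !perm_bracketE merge_all_ordS map_lift_perm -map_take -map_drop /=.
set W := map s (enum 'I_r).
have sizeW : size W = r by rewrite size_map size_enum_ord.
have nthW : nth (s p) W p = s p.
  by rewrite (nth_map p) ?size_enum_ord // nth_ord_enum.
have uniqW : uniq W by rewrite map_inj_uniq ?enum_uniq //; exact: perm_inj.
have EW : W = take p W ++ s p :: drop p.+1 W.
  by rewrite -[in LHS](cat_take_drop p W) (drop_nth (s p)) ?sizeW // nthW.
have uniqt : uniq (take p W ++ s p :: drop p.+1 W) by rewrite -EW.
rewrite (drop_nth (s p)) ?sizeW // nthW [in RHS]EW.
move: uniqt; move: (take p W) (drop p.+1 W) => t1 t2 uniqt.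
rewrite !word_entries_cat merge_right_cat ?ord0_notin_entries //=.
rewrite map_cat map_unlift_entry_lift /= unlift_word_entries_lift.
rewrite /unlift_entry /word_entries /= unlift_none liftK /= eqxx.
(* The letter [s p] occurs only once in the word, so the changed family agrees with the old one on
   [t1] and [t2]. *)
move: uniqt; rewrite uniq_catC /= mem_cat negb_or => /andP[/andP[n2 n1] _].
congr (head _ (merge_all _ (_ ++ _ :: rcons _ _) _)).2.
  apply/eq_in_map => j jt; rewrite ifN //.
  by apply: contraNneq n1 => <-.
apply/eq_in_map => j jt; rewrite ifN //.
by apply: contraNneq n2 => <-.
Qed.

(* The first contraction involves the entry [x ord0] and the one to its right,
   which is either some [x i] or the last entry [y]. *)
Lemma sum_perm_bracketS r (x : 'I_r.+1 -> g) y :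
  \sum_(w : 'S_r.+1) perm_bracket x y w
  = \sum_(i < r) \sum_(s : 'S_r)
      perm_bracket (fun j => if j == i then tri (x ord0) (x (lift ord0 j))
                             else x (lift ord0 j)) y s
    + \sum_(s : 'S_r) perm_bracket (fun j => x (lift ord0 j)) (tri (x ord0) y) s.
Proof.
rewrite sum_lift_perm big_ord_recr /=.
congr (_ + _); last by apply: eq_bigr => s _; exact: perm_bracket_lift_max.
rewrite exchange_big [RHS]exchange_big /=.
(* For fixed [s], the letter [i] is traded for its position [p], with [i = s p]. *)
apply: eq_bigr => s _; rewrite [RHS](reindex_inj (@perm_inj _ s)).
by apply: eq_bigr => p _; rewrite perm_bracket_lift.
Qed.

(** By conversion, [block_bracket x I] is [seq_bracket #|I|.-1 [seq x i | i <- enum I]]. With the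
    length as a separate argument, [#|I|] can be rewritten although the type of [w] depends on
    it. *)
Definition seq_bracket r (s : seq g) : g :=
  \sum_(w : 'S_r) perm_bracket (fun j : 'I_r => nth 0 s j) (last 0 s) w.

Lemma seq_bracket0 a : seq_bracket 0 [:: a] = a.
Proof.
rewrite /seq_bracket (big_pred1 (1%g : 'S_0)) => [|w]; last first.
  by apply/esym/eqP/permP => -[].
by rewrite perm_bracketE enum_ord0.
Qed.

(** The right neighbour of [a] may be any entry of [t], the last one being the [y] of the bracket;
    so both terms of [sum_perm_bracketS] fit into one sum over positions in [t]. *)
Lemma seq_bracketS r a (t : seq g) : size t = r.+1 ->
  seq_bracket r.+1 (a :: t)
  = \sum_(i < r.+1) seq_bracket r (set_nth 0 t i (tri a (nth 0 t i))).
Proof.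
move=> szt; rewrite /seq_bracket sum_perm_bracketS /= big_ord_recr /=.
have last_t : last a t = nth 0 t r.
  by case: t szt => //= b t [<-]; rewrite (last_nth 0).
have last_set_nth i : (i < r.+1)%N ->
    forall v, last 0 (set_nth 0 t i v) = nth 0 (set_nth 0 t i v) r.
  by move=> ir v; rewrite (last_nth 0) size_set_nth szt (maxn_idPr ir).
congr (_ + _).
  apply: eq_bigr => i _; apply: eq_bigr => w _.
  rewrite last_set_nth ?ltnS ?(ltnW (ltn_ord _)) // nth_set_nth /= gtn_eqF //.
  rewrite last_t; congr perm_bracket; apply: funext => j.
  by rewrite add0n nth_set_nth /= (inj_eq val_inj); case: eqP => // ->.
apply: eq_bigr => w _; rewrite last_set_nth // nth_set_nth /= eqxx.
rewrite last_t; congr perm_bracket; apply: funext => j.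
by rewrite add0n nth_set_nth /= ltn_eqF.
Qed.

Lemma block_bracket1 n (x : 'I_n -> g) a : block_bracket x [set a] = x a.
Proof.
by rewrite -[LHS]/(seq_bracket _ _) cards1 enum_set1 seq_bracket0.
Qed.

(** Being least, [a] heads the enumeration of [a |: B]; the positions after it correspond to the
    elements of [B], which turns [seq_bracketS] into a sum over [B]. *)
Lemma block_bracketU1 n (x : 'I_n -> g) (a : 'I_n) (B : {set 'I_n}) :
  {in B, forall i : 'I_n, (a < i)%N} -> B != set0 ->
  block_bracket x (a |: B)
  = \sum_(i in B) block_bracket (fun j => if j == i then tri (x a) (x j) else x j) B.
Proof.
move=> aB; rewrite -card_gt0 => B0.
have nB : a \notin B by apply/negP => /aB; rewrite ltnn.
rewrite -[LHS]/(seq_bracket _ _) cardsU1 nB enum_setU1 //=.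
rewrite -(prednK B0) seq_bracketS ?size_map -?cardE ?prednK //.
rewrite -[RHS]big_enum /= (big_nth a) -cardE big_mkord.
apply: eq_bigr => -[i iB] _ /=.
rewrite -[RHS]/(seq_bracket _ _); congr seq_bracket.
apply: (@eq_from_nth _ 0) => [|j]; rewrite size_set_nth size_map -cardE (maxn_idPr iB).
  by rewrite size_map -cardE.
move=> jB; rewrite nth_set_nth /= !(nth_map a) -?cardE //.
by rewrite nth_uniq ?enum_uniq -?cardE //; case: eqP => // ->.
Qed.

Lemma eq_block_bracket n (x y : 'I_n -> g) (B : {set 'I_n}) : {in B, x =1 y} ->
  block_bracket x B = block_bracket y B.
Proof.
move=> xy; rewrite -[LHS]/(seq_bracket _ _) -[RHS]/(seq_bracket _ _).
congr seq_bracket; apply/eq_in_map => i; rewrite mem_enum; exact: xy.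
Qed.

End Brackets.
(** * Partitions of [a |: D] *)

Section PartitionU1.
Variables (T : finType) (a : T).
Implicit Types (B C D : {set T}) (P Q : {set {set T}}).

(** Blocks are nonempty. This keeps the subtraction in the exponent of the sign from being
    truncated. *)
Lemma leq_card_partition P D : partition P D -> (#|P| <= #|D|)%N.
Proof.
move=> PD; rewrite (card_partition PD) -sum1_card; apply: leq_sum => B BP.
by rewrite card_gt0 (partition_neq0 PD).
Qed.

Definition grow_block Q B := (a |: B) |: (Q :\ B).

(* The inverse of [grow_block], for [P] not having [[set a]] as a block. *)
Definition shrink_block P :=
  let C := pblock P a in ((C :\ a) |: (P :\ C), C :\ a).

(** Since [a] lies in no block of [Q], the set [a |: B] is new and is the block of [a]; it differs
    from [[set a]] because [B] is nonempty. *)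
Lemma grow_blockP D Q B : a \notin D -> partition Q D -> B \in Q ->
  [/\ partition (grow_block Q B) (a |: D), [set a] \notin grow_block Q B,
      shrink_block (grow_block Q B) = (Q, B) & #|grow_block Q B| = #|Q| ].
Proof.
move=> aD QD BQ.
have aQ C : C \in Q -> a \notin C.
  by move=> CQ; apply: contra aD; apply/subsetP/(partitionS QD CQ).
have nU : a |: B \notin Q :\ B.
  by apply/negP; rewrite !inE => /andP[_ /aQ]; rewrite !inE eqxx.
have part : partition (grow_block Q B) (a |: D).
  have -> : a |: D = (a |: B) :|: (D :\: B).
    apply/setP => x; rewrite !inE -orbA; congr (_ || _).
    by case: (boolP (x \in B)) => //= /(subsetP (partitionS QD BQ)) ->.
  apply: partitionU1; first exact: partitionD1.
    by apply/set0Pn; exists a; rewrite setU11.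
  rewrite -setI_eq0; apply/eqP/setP => x; rewrite !inE.
  by case: eqP => [->|_]; [rewrite (negPf aD) andbF | case: (x \in B)].
split=> //.
- rewrite !inE negb_or; apply/andP; split.
    have /set0Pn[x xB] := partition_neq0 QD BQ.
    apply/eqP => /setP/(_ x); rewrite !inE xB orbT => /eqP xa.
    by have := aQ _ BQ; rewrite -xa xB.
  by apply/negP => /andP[_ /aQ]; rewrite inE eqxx.
- rewrite /shrink_block (@def_pblock _ _ (a |: B)) ?setU11 //; last first.
    exact: partition_trivIset part.
  by rewrite /grow_block !setU1K ?aQ // setD1K.
- by rewrite cardsU1 nU (cardsD1 B Q) BQ.
Qed.

Lemma shrink_blockP D P : a \notin D -> partition P (a |: D) -> [set a] \notin P ->
  [/\ partition (shrink_block P).1 D, (shrink_block P).2 \in (shrink_block P).1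
    & grow_block (shrink_block P).1 (shrink_block P).2 = P].
Proof.
move=> aD PD aP; rewrite /shrink_block /=; set C := pblock P a.
have tP := partition_trivIset PD.
have acov : a \in cover P by rewrite (cover_partition PD) setU11.
have CP : C \in P by exact: pblock_mem.
have aC : a \in C by rewrite mem_pblock.
have C0 : C :\ a != set0.
  by apply: contraNneq aP => C0; rewrite -[[set a]]setU0 -C0 setD1K.
(* Otherwise an element of [C :\ a] would lie in two distinct blocks. Hence adjoining [C :\ a] can
   be undone. *)
have nC : C :\ a \notin P :\ C.
  have [x xC] := set0Pn _ C0; apply/negP => /setD1P[neq CaP].
  have xC' : x \in C by case/setD1P: xC.
  by case/eqP: neq; rewrite -(def_pblock tP CaP xC) (def_pblock tP CP xC').
split.
- have -> : D = (C :\ a) :|: ((a |: D) :\: C).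
    apply/setP => x; rewrite !inE; case: (eqVneq x a) => [->|xa] /=.
      by rewrite (negPf aD) aC.
    case: (boolP (x \in C)) => //= xC.
    by have := subsetP (partitionS PD CP) _ xC; rewrite !inE (negPf xa).
  apply: partitionU1 => //; first exact: partitionD1.
  rewrite -setI_eq0; apply/eqP/setP => x; rewrite !inE.
  by case: (x \in C); rewrite ?andbF.
- by rewrite setU11.
- by rewrite /grow_block setU1K // !setD1K.
Qed.

(** If [[set a]] is a block, deleting it leaves a partition of [D]; if not, [shrink_block] takes [a]
    out of its block and records which block that was. *)
Lemma big_partitionU1 (V : nmodType) D (F : {set {set T}} -> V) : a \notin D ->
  \sum_(P | partition P (a |: D)) F P
  = \sum_(Q | partition Q D) (F ([set a] |: Q) + \sum_(B in Q) F (grow_block Q B)).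
Proof.
move=> aD; rewrite (bigID (fun P => [set a] \in P)) big_split; congr (_ + _).
  rewrite (reindex_onto (fun Q => [set a] |: Q) (fun P => P :\ [set a])) /=; last first.
    by move=> P /andP[_ ?]; rewrite setD1K.
  apply: eq_bigl => Q; rewrite setU11 andbT; apply/andP/idP => [[PD /eqP QE]|QD].
    have := partitionD1 PD (setU11 _ _); rewrite QE.
    by rewrite setU1K.
  split; last first.
    rewrite setU1K //; apply: contra aD => /(partitionS QD)/subsetP; apply.
    by rewrite inE.
  apply: partitionU1 => //; first by apply/set0Pn; exists a; rewrite inE.
  by rewrite disjoints1.
rewrite pair_big_dep /=.
rewrite (reindex_onto (fun u => grow_block u.1 u.2) shrink_block) /=; last first.
  move=> P /andP[PD aP]; by have [] := shrink_blockP aD PD aP.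
apply: eq_bigl => -[Q B] /=; apply/andP/andP => [[/andP[PD aP] /eqP E]|[QD BQ]].
  by have := shrink_blockP aD PD aP; rewrite E => -[-> ->].
by have [-> -> -> _] := grow_blockP aD QD BQ.
Qed.

End PartitionU1.

(** * The order of the blocks by their maxima *)

Section Blocks.
Variable n : nat.
Implicit Types (B C D : {set 'I_n}) (P Q : {set {set 'I_n}}).

Definition block_max B : nat := (\max_(i in B) i)%N.

Lemma perm_blocks_by_max P : perm_eq (blocks_by_max P) (enum P).
Proof. by rewrite /blocks_by_max perm_sort. Qed.

Lemma mem_blocks_by_max P : blocks_by_max P =i P.
Proof. by move=> B; rewrite (perm_mem (perm_blocks_by_max P)) mem_enum. Qed.

Lemma uniq_blocks_by_max P : uniq (blocks_by_max P).
Proof. by rewrite (perm_uniq (perm_blocks_by_max P)) enum_uniq. Qed.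

Lemma sorted_blocks_by_max P : sorted leq (map block_max (blocks_by_max P)).
Proof. by rewrite sorted_map; apply: sort_sorted => B C; exact: leq_total. Qed.

(** Nonemptiness matters: on the empty set the maximum is the default 0, attained by no member. *)
Lemma partition_block_max P D :
  partition P D -> {in P, forall B, exists2 i, i \in B & block_max B = i}.
Proof.
move=> PD B BP; have B0 : (0 < #|B|)%N.
  by rewrite card_gt0 (partition_neq0 PD).
by have [i iB E] := eq_bigmax_cond (@nat_of_ord n) B0; exists i.
Qed.

(** A maximum shared by two blocks would be a common element. So distinct blocks have distinct
    maxima, and only one arrangement is sorted. *)
Lemma blocks_by_max_eq P D s : partition P D -> uniq s -> s =i P ->
  sorted leq (map block_max s) -> blocks_by_max P = s.
Proof.
move=> PD us sP sorted_s; apply: (@sorted_eq_in _ (relpre block_max leq)).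
- by move=> ? ? ? _ _ _; exact: leq_trans.
- move=> B C; rewrite !mem_blocks_by_max => BP CP /anti_leq.
  have [i iB ->] := partition_block_max PD BP.
  have [j jC ->] := partition_block_max PD CP => /val_inj ij.
  have tP := partition_trivIset PD.
  by rewrite -(def_pblock tP BP iB) ij (def_pblock tP CP jC).
- by rewrite -sorted_map sorted_blocks_by_max.
- by rewrite -sorted_map.
- by apply: uniq_perm => // [|B]; rewrite ?uniq_blocks_by_max // mem_blocks_by_max sP.
Qed.

Section Min.
Variables (a : 'I_n) (D : {set 'I_n}).
Hypothesis aD : {in D, forall i : 'I_n, (a < i)%N}.
Variable (Q : {set {set 'I_n}}).
Hypothesis QD : partition Q D.

Lemma min_notin : a \notin D.
Proof. by apply/negP => /aD; rewrite ltnn. Qed.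

Lemma blocks_by_max_set1U :
  blocks_by_max ([set a] |: Q) = [set a] :: blocks_by_max Q.
Proof.
have aQ : [set a] \notin Q.
  by apply: contra min_notin => /(partitionS QD)/subsetP; apply; rewrite inE.
apply: (@blocks_by_max_eq _ (a |: D)).
- apply: partitionU1 => //; first by apply/set0Pn; exists a; rewrite inE.
  by rewrite disjoints1 min_notin.
- by rewrite /= mem_blocks_by_max aQ uniq_blocks_by_max.
- by move=> B; rewrite !inE mem_blocks_by_max.
rewrite /= path_min_sorted ?sorted_blocks_by_max //.
apply/allP => _ /mapP[B + ->]; rewrite mem_blocks_by_max => BQ.
have [i iB ->] := partition_block_max QD BQ; rewrite /block_max big_set1.
exact/ltnW/aD/(subsetP (partitionS QD BQ)).
Qed.

(** As [a] is below every element of [B], growing [B] leaves its maximum, and so its place,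
    unchanged. *)
Lemma blocks_by_max_grow B : B \in Q ->
  blocks_by_max (grow_block a Q B)
  = [seq if C == B then a |: B else C | C <- blocks_by_max Q].
Proof.
move=> BQ; have aQ C : C \in Q -> a \notin C.
  by move=> CQ; apply: contra min_notin; apply/subsetP/(partitionS QD CQ).
have [PD _ _ _] := grow_blockP min_notin QD BQ.
apply: (blocks_by_max_eq PD).
- rewrite map_inj_in_uniq ?uniq_blocks_by_max // => C C'.
  rewrite !mem_blocks_by_max => /aQ aC /aQ aC'.
  case: eqP => [->|_]; case: eqP => [->|_] // E.
    by rewrite -E setU11 in aC'.
  by rewrite E setU11 in aC.
- move=> C; apply/mapP/idP => [[C' + ->]|].
    rewrite mem_blocks_by_max => C'Q; case: eqP => [_|/eqP neq].
      exact: setU11.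
    by rewrite !inE neq C'Q orbT.
  rewrite !inE => /orP[/eqP->|/andP[neq CQ]].
    by exists B; rewrite ?mem_blocks_by_max ?eqxx.
  by exists C; rewrite ?mem_blocks_by_max ?(negPf neq).
suff -> : map block_max [seq if C == B then a |: B else C | C <- blocks_by_max Q]
        = map block_max (blocks_by_max Q) by exact: sorted_blocks_by_max.
rewrite -map_comp; apply/eq_in_map => C _ /=; case: eqP => // ->.
rewrite [LHS]/block_max big_setU1 ?aQ //=; apply/maxn_idPr.
rewrite -/(block_max B); have [i iB ->] := partition_block_max QD BQ.
exact/ltnW/aD/(subsetP (partitionS QD BQ)).
Qed.

End Min.
End Blocks.

(** * The recursion for the inverse *)

Lemma circ_uea_in (k : fieldType) (g : postLieAlg k)
    (tri : {bilinear uea g -> uea g -> uea g}) (triP : is_tri_extension tri) x v :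
  circ tri (uea_in x) v = uea_in x * v + tri (uea_in x) v.
Proof.
rewrite /circ /uea_coprod uea_liftE /= /primitive linearD /= !tens_lift_pure.
by rewrite /= /circ_sweedler mul1r (tri_unitl triP).
Qed.

(** Without repetitions in [s], the test [j == i] on indices singles out one position of the
    product. *)
Lemma tri_uea_in_prod (k : fieldType) (g : postLieAlg k)
    (tri : {bilinear uea g -> uea g -> uea g}) (triP : is_tri_extension tri)
    (I : eqType) (s : seq I) (y : I -> g) x : uniq s ->
  tri (uea_in x) (\prod_(j <- s) uea_in (y j))
  = \sum_(i <- s) \prod_(j <- s)
      uea_in (if j == i then pl_tri g x (y j) else y j).
Proof.
move=> us; rewrite big_tnth (tri_prodr triP) [RHS]big_tnth.
apply: eq_bigr => i _; rewrite [RHS]big_tnth; apply: eq_bigr => j _.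
by rewrite (inj_eq (tuple_uniqP (in_tuple s) us)).
Qed.

Section GuinOudomInverse.
Variables (k : fieldType) (g : postLieAlg k).
Variables (tri : {bilinear uea g -> uea g -> uea g}) (triP : is_tri_extension tri).
Variables (phi : {linear uea (sub_adjacent g) -> uea g}).
Hypothesis phiP : is_guin_oudom tri phi.
Variables (phi_inv : uea g -> uea (sub_adjacent g)).
Hypotheses (phiK : cancel phi phi_inv) (phi_invK : cancel phi_inv phi).
Local Notation sub_in := (@uea_in k (sub_adjacent g)).

Lemma guin_oudom_uea_inM (x : g) w :
  phi (sub_in x * w) = circ tri (uea_in x) (phi w).
Proof.
(* The explicit form of [circ] shows that it is linear in its right factor, which reduces [w] to a
   monomial. *)
have [s ->] := uea_span w; rewrite circ_uea_in // mulr_sumr !linear_sum /=.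
rewrite mulr_sumr -big_split; apply: eq_bigr => -[c t] _ /=.
rewrite -scalerAr !linearZ /= -scalerAr -scalerDr -circ_uea_in //.
by have := phiP (x :: t); rewrite !big_cons -phiP => ->.
Qed.

Lemma phi_inv_uea_inM (x : g) v :
  phi_inv (uea_in x * v) = sub_in x * phi_inv v - phi_inv (tri (uea_in x) v).
Proof.
apply: (can_inj phiK); rewrite linearB /= guin_oudom_uea_inM !phi_invK.
by rewrite circ_uea_in // addrK.
Qed.

(** The inverse is a bare function; its additivity is inherited from [phi]. *)
Lemma phi_inv_sum (I : Type) (s : seq I) (F : I -> uea g) :
  phi_inv (\sum_(i <- s) F i) = \sum_(i <- s) phi_inv (F i).
Proof.
apply: (can_inj phiK); rewrite phi_invK linear_sum.
by apply: eq_bigr => i _; rewrite /= phi_invK.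
Qed.

Section Min.
Variables (n : nat) (a : 'I_n) (D : {set 'I_n}).
Hypothesis aD : {in D, forall i : 'I_n, (a < i)%N}.

(** An index [i] in [B] lies in no other block, so changing [x i] affects the factor of [B] alone,
    and [block_bracketU1] sums these changes to the grown block. *)
Lemma prod_blocks_grow (x : 'I_n -> g) (Q : {set {set 'I_n}}) (B : {set 'I_n}) :
  partition Q D -> B \in Q ->
  \prod_(C <- blocks_by_max (grow_block a Q B)) sub_in (block_bracket x C)
  = \sum_(i in B) \prod_(C <- blocks_by_max Q)
      sub_in (block_bracket (fun j => if j == i then pl_tri g (x a) (x j) else x j) C).
Proof.
move=> QD BQ; rewrite (blocks_by_max_grow aD QD BQ) big_map.
have := uniq_blocks_by_max Q; have := BQ; rewrite -mem_blocks_by_max.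
have : {subset blocks_by_max Q <= Q} by move=> C; rewrite mem_blocks_by_max.
move: (blocks_by_max Q) => L + /splitPr E; case: L / E => L1 L2 subQ; rewrite uniq_catC /= mem_cat negb_or.
case/andP=> /andP[nL2 nL1] _.
rewrite big_cat big_cons /= eqxx block_bracketU1 ?(partition_neq0 QD) //; last first.
  by move=> i iB; exact/aD/(subsetP (partitionS QD BQ)).
rewrite linear_sum mulr_suml mulr_sumr; apply: eq_bigr => i iB.
have same (L : seq {set 'I_n}) : {subset L <= Q} -> B \notin L ->
    \prod_(C <- L) sub_in (block_bracket x (if C == B then a |: B else C))
    = \prod_(C <- L) sub_in
        (block_bracket (fun j => if j == i then pl_tri g (x a) (x j) else x j) C).
  move=> LQ nBL; apply: eq_big_seq => C CL.
  have CB : C != B by apply: contraNneq nBL => <-.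
  rewrite (negPf CB); congr uea_in; apply: eq_block_bracket => j jC.
  rewrite ifN //; apply: contraNneq CB => ji; have tQ := partition_trivIset QD.
  by rewrite -(def_pblock tQ (LQ _ CL) jC) ji (def_pblock tQ BQ iB).
rewrite [RHS]big_cat big_cons /= !same // => C CL; apply: subQ.
  by rewrite mem_cat inE CL !orbT.
by rewrite mem_cat CL.
Qed.

End Min.

(** Stated for subsets of a fixed ['I_n], so that removing the least index needs no renumbering, and
    for all [x], since the induction changes [x]. *)
Lemma phi_inv_prod_set n (D : {set 'I_n}) (x : 'I_n -> g) :
  phi_inv (\prod_(i <- enum D) uea_in (x i))
  = \sum_(P : {set {set 'I_n}} | partition P D)
      (-1) ^+ (#|D| - #|P|) *:
        \prod_(B <- blocks_by_max P) sub_in (block_bracket x B).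
Proof.
have [m] := ubnP #|D|; elim: m D x => // m IHm D x.
have [-> _|[i0 i0D]] := set_0Vmem D.
  rewrite enum_set0 big_nil (big_pred1 set0) => [|P]; last by rewrite partition_set0.
  rewrite /blocks_by_max enum_set0 big_nil !cards0 scale1r.
  by apply: (can_inj phiK); rewrite phi_invK; have := phiP [::]; rewrite !big_nil.
pose a := [arg min_(i < i0 in D) i]%N.
have [aD minD] : a \in D /\ {in D, forall i : 'I_n, (a <= i)%N}.
  by rewrite /a; case: arg_minnP.
rewrite -(setD1K aD); set E := D :\ a.
have aE : {in E, forall i : 'I_n, (a < i)%N}.
  by move=> i /setD1P[neq /minD]; rewrite leq_eqVlt eq_sym (inj_eq val_inj) (negPf neq).
have nE : a \notin E by rewrite !inE eqxx.
rewrite cardsU1 nE => ltm; have {}IHm y := IHm E y ltm.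
rewrite enum_setU1 // big_cons phi_inv_uea_inM tri_uea_in_prod ?enum_uniq //.
(* The first summand gives the partitions with the block [[set a]], the second those where [a] joins
   a block of [Q]. *)
rewrite phi_inv_sum IHm big_partitionU1 // big_split /=; congr (_ + _).
  rewrite mulr_sumr; apply: eq_bigr => Q QE.
  rewrite cardsU1 (_ : [set a] \notin Q) => [|]; last first.
    by apply: contra nE => /(partitionS QE)/subsetP; apply; rewrite inE.
  rewrite subnDl (blocks_by_max_set1U aE QE) big_cons block_bracket1.
  by rewrite scalerAr.
rewrite big_enum /=; under eq_bigr do rewrite IHm.
(* For fixed [Q], the sum over [i] in [E] is regrouped by the block of [Q] containing [i]. *)
rewrite exchange_big -sumrN; apply: eq_bigr => Q QE /=.
rewrite -scaler_sumr (set_partition_big _ QE) scaler_sumr -sumrN.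
apply: eq_bigr => B BQ; have [_ _ _ ->] := grow_blockP nE QE BQ.
(* The set grows by one element and the number of blocks stays, so the exponent rises by one and
   absorbs the minus sign. *)
by rewrite add1n subSn ?(leq_card_partition QE) // exprS mulN1r scaleNr
   (prod_blocks_grow aE x QE BQ).
Qed.

End GuinOudomInverse.

Theorem theorem3p5 (k : closedFieldType) (k_char0 : [pchar k] =i pred0)
    (g : postLieAlg k)
    (tri : {bilinear uea g -> uea g -> uea g}) (triP : is_tri_extension tri)
    (phi : {linear uea (sub_adjacent g) -> uea g}) (phiP : is_guin_oudom tri phi)
    (phi_inv : uea g -> uea (sub_adjacent g))
    (phiK : cancel phi phi_inv) (phi_invK : cancel phi_inv phi)
    (n : nat) (x : 'I_n -> g) :
  phi_inv (\prod_(i < n) uea_in (x i))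
  = \sum_(P : {set {set 'I_n}} | partition P [set: 'I_n])
      (-1) ^+ (n - #|P|) *:
        \prod_(B <- blocks_by_max P)
          @uea_in k (sub_adjacent g) (block_bracket x B).
Proof.
have := phi_inv_prod_set triP phiP phiK phi_invK [set: 'I_n] x.
by rewrite enum_setT cardsT card_ord => <-.
Qed.
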